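(* Let $I=[a,b]$ be a compact interval, let $(X,d)$ be a metric space, let $g:I\to\mathbb R$ be nondecreasing, and let $F:I\to\mathcal K(X)$. Suppose that, for some $\alpha\ge1$, $[F]_{\alpha,g}<\infty$ (that is, $F$ is $g$-Hölder of exponent $\alpha$). Then, for every $\theta\in I$ and every $x_\theta\in F(\theta)$, there exists a map $f:I\to X$ with $f(t)\in F(t)$ for every $t\in I$ and $f(\theta)=x_\theta$ such that, for every $s,t\in I$ with $s<t$, $$d(f(s),f(t))\le V_H(F;[s,t])\le[F]_{\alpha,g}\,|g(t)-g(s)|^\alpha$$ and $$V(f;[s,t])\le V_H(F;[s,t]).$$ Consequently, $[f]_{\alpha,g}\le[F]_{\alpha,g}$.
   Context: $\mathcal K(X)$ is the family of all nonempty compact subsets of $X$, and $d_H$ is the Hausdorff distance on $\mathcal K(X)$ induced by $d$. $F:I\to\mathcal K(X)$ is $g$-Hölder of exponent $\alpha$ if there is $L\ge0$ with $d_H(F(s),F(t))\le L|g(t)-g(s)|^\alpha$ for all $s,t\in I$; $[F]_{\alpha,g}$ denotes the minimum such $L$ (and $[F]_{\alpha,g}<\infty$ means such an $L$ exists). For single-valued $f:I\to X$, $[f]_{\alpha,g}$ is the minimum $L\ge0$ with $d(f(s),f(t))\le L|g(t)-g(s)|^\alpha$ for all $s,t\in I$. For $a\le s<t\le b$, $V_H(F;[s,t])=\sup_P\sum_{i=1}^n d_H(F(t_{i-1}),F(t_i))$ and $V(f;[s,t])=\sup_P\sum_{i=1}^n d(f(t_{i-1}),f(t_i))$, where $P$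 ranges over all finite partitions $s=t_0<\cdots<t_n=t$. *)

(* Defs.v *)
From HB Require Import structures.
From mathcomp Require Import all_boot all_order all_algebra.
From mathcomp Require Import all_classical all_reals all_analysis.

Set Implicit Arguments.
Unset Strict Implicit.
Unset Printing Implicit Defensive.

Import Order.TTheory GRing.Theory Num.Theory.
Import numFieldNormedType.Exports.

Local Open Scope classical_set_scope.
Local Open Scope ring_scope.

Definition nonempty_compacts (X : topologicalType) : set (set X) :=
  [set A | A !=set0 /\ compact A].

(* Distances take values in the extended reals so that the Hausdorff distance,
   the variation and the best Hoelder constant have no junk values; see
   hausdorff_dist_fin and holder_const_min below. *)
Definition dist (R : realType) (X : metricType R) (x y : X) : \bar R :=
  (mdist x y)%:E.

Definition hausdorff_dist (R : realType) (X : metricType R) (A B : set X) :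
    \bar R :=
  maxe (ereal_sup [set ereal_inf [set dist x y | y in B] | x in A])
       (ereal_sup [set ereal_inf [set dist x y | x in A] | y in B]).

(* The notions below are parameterized by a distance delta on the codomain:
   they are used both for delta := dist and for delta := hausdorff_dist.
   Maps on [a, b] are maps on R whose values outside [a, b] are irrelevant. *)

Definition is_holder (R : realType) (T : Type) (delta : T -> T -> \bar R)
    (a b : R) (g : R -> R) (alpha : R) (h : R -> T) (L : R) : Prop :=
  0 <= L /\ forall s t, s \in `[a, b] -> t \in `[a, b] ->
    (delta (h s) (h t) <= (L * `|g t - g s| `^ alpha)%:E)%E.

(* +oo when h is not Hoelder, and otherwise a minimum (holder_const_min). *)
Definition holder_const (R : realType) (T : Type) (delta : T -> T -> \bar R)
    (a b : R) (g : R -> R) (alpha : R) (h : R -> T) : \bar R :=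
  ereal_inf [set L%:E | L in is_holder delta a b g alpha h].

(* The partition s = t_0 < ... < t_n = t is encoded as p = [:: t_1; ...; t_n],
   following itv_partition. *)
Definition dist_variation (R : realType) (T : Type)
    (delta : T -> T -> \bar R) (h : R -> T) (s t : R) : \bar R :=
  ereal_sup [set (\sum_(0 <= i < size p)
                    delta (h (nth t (s :: p) i)) (h (nth t (s :: p) i.+1)))%E
            | p in itv_partition s t].

Section sanity.
Context (R : realType).

Lemma hausdorff_dist_fin (X : metricType R) (A B : set X) :
  nonempty_compacts A -> nonempty_compacts B ->
  hausdorff_dist A B \is a fin_num.
Proof.
move=> [[x0 Ax0] cA] [[y0 By0] cB].
have bnd (C : set X) (z : X) : compact C ->
    exists M : R, forall x, C x -> mdist z x <= M.
  move=> /compact_near_coveringP /(_ R (pinfty_nbhs R) (fun M x => mdist z x <= M)).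
  case=> [x _|M [_ HM]].
    exists (ball x 1, [set M | mdist z x + 1 < M]) => /=.
      split; first exact: nbhsx_ballx.
      exists (mdist z x + 1); split => [|M]; first exact: num_real.
      by [].
    case=> y M /= []; rewrite ballEmdist/= => xy zM.
    rewrite (le_trans (metric_triangle _ x _))// (le_trans _ (ltW zM))//.
    by rewrite lerD2l ltW.
  by exists (M + 1) => x Cx; apply: HM => //; rewrite ltrDl.
have fin (C : set X) (D : set X) (c0 d0 : X) : C c0 -> compact C -> D d0 ->
    ereal_sup [set ereal_inf [set dist x y | y in D] | x in C] \is a fin_num.
  move=> Cc cC Dd; have [M HM] := bnd C d0 cC.
  rewrite ge0_fin_numE.
    apply: (@le_lt_trans _ _ M%:E); last exact: ltry.
    apply: ge_ereal_sup => _ [x Cx <-].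
    apply: (@le_trans _ _ (dist x d0)); first by apply: ereal_inf_lbound; exists d0.
    by rewrite /dist metric_sym lee_fin HM.
  apply: (@le_trans _ _ (ereal_inf [set dist c0 y | y in D])).
    by apply: le_ereal_inf_tmp => _ [y _ <-]; rewrite lee_fin mdist_ge0.
  by apply: ereal_sup_ubound; exists c0.
have h1 := fin A B x0 y0 Ax0 cA By0.
have h2 := fin B A y0 x0 By0 cB Ax0.
rewrite /hausdorff_dist.
have -> : [set ereal_inf [set dist x y | x in A] | y in B] =
          [set ereal_inf [set dist x y | y in A] | x in B].
  apply: eq_imagel => y _; congr ereal_inf; apply: eq_imagel => x _.
  by rewrite /dist metric_sym.
by rewrite /maxe; case: ifP.
Qed.

Lemma holder_const_min (T : Type) (delta : T -> T -> \bar R) (a b : R)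
    (g : R -> R) (alpha : R) (h : R -> T) :
  (holder_const delta a b g alpha h < +oo)%E ->
  exists L : R, [/\ holder_const delta a b g alpha h = L%:E,
    is_holder delta a b g alpha h L &
    forall L', is_holder delta a b g alpha h L' -> L <= L'].
Proof.
set c := holder_const _ _ _ _ _ _ => coo.
have c0 : (0 <= c)%E.
  by apply: le_ereal_inf_tmp => _ [L [L0 _] <-]; rewrite lee_fin.
have cfin : c \is a fin_num by rewrite ge0_fin_numE.
have cle L' : is_holder delta a b g alpha h L' -> fine c <= L'.
  move=> HL'; rewrite -lee_fin fineK//.
  by apply: ereal_inf_lbound; exists L'.
exists (fine c); split; [by rewrite fineK| |exact: cle].
split; first exact: fine_ge0.
move=> s t sab tab.
have [L1 HL1] : exists L1, is_holder delta a b g alpha h L1.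
  apply: contrapT => noL; move: coo; rewrite /c /holder_const.
  suff -> : is_holder delta a b g alpha h = set0 by rewrite image_set0 ereal_inf0 ltxx.
  by apply/seteqP; split => // L HL; apply: noL; exists L.
set w := _ `^ _.
have w0 : 0 <= w by exact: powR_ge0.
apply/lee_addgt0Pr => e e0.
have w1 : 0 < w + 1 by rewrite ltr_wpDl.
have : (ereal_inf [set L%:E | L in is_holder delta a b g alpha h]
   < (fine c + e / (w + 1))%:E)%E.
  rewrite -[X in (X < _)%E]/c -(fineK cfin) lte_fin ltrDl.
  by rewrite divr_gt0.
move=> /ereal_inf_lt [_ [L HL <-]]; rewrite lte_fin => /ltW Lle.
apply: (le_trans (HL.2 s t sab tab)); rewrite -EFinD lee_fin -/w.
apply: (le_trans (ler_wpM2r w0 Lle)); rewrite mulrDl lerD2l.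
by rewrite -mulrA ler_piMr ?(ltW e0)// mulrC ler_pdivrMr// mul1r lerDl.
Qed.

End sanity.

(* Main.v *)
(** V(s, t) := V_H(F; [s, t]) is superadditive and dominates d_H(F s, F t).
    Compact values make the Hausdorff distance attained, so on any finite set
    of times one can walk away from theta, to the right and to the left, by
    always picking a nearest point of the next value; superadditivity makes this
    finite selection V-Lipschitz. By Tychonoff the product of the F t is
    compact, and a cluster point of the finite selections is V-Lipschitz on the
    whole interval. *)
Require Import Defs.
From HB Require Import structures.
From mathcomp Require Import all_boot all_order all_algebra.
From mathcomp Require Import all_classical all_reals all_analysis.
Import Order.TTheory GRing.Theory Num.Theory.
Import numFieldNormedType.Exports.
Local Open Scope classical_set_scope.
Local Open Scope ring_scope.

(** * Sums of suprema and superadditivity of powers *)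

Lemma ge_adde_ereal_sup (R : realType) (A B : set (\bar R)) (c : \bar R) :
  (ereal_sup A < +oo)%E -> (ereal_sup B < +oo)%E ->
  (forall x y, A x -> B y -> (x + y <= c)%E) ->
  (ereal_sup A + ereal_sup B <= c)%E.
Proof.
have aux (C : set (\bar R)) x : (x < +oo)%E ->
    (forall y, C y -> (x + y <= c)%E) -> (x + ereal_sup C <= c)%E.
  case: x => [r _ rC|//|_ _]; last by rewrite addNye leNye.
  rewrite addeC -leeBrDr//; apply: ge_ereal_sup => y Cy.
  by rewrite leeBrDr// addeC rC.
move=> Aoo Boo AB; apply: (aux) => // y By.
rewrite addeC; apply: aux => [|x Ax]; last by rewrite addeC AB.
by rewrite (le_lt_trans _ Boo)//; exact: ereal_sup_ubound.
Qed.

(** Each power splits as [z * z ^ (p - 1)], and the second factor is nondecreasing in [z] because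
    [p - 1] is nonnegative. *)
Lemma powR_superadd (R : realType) (x y p : R) : 0 <= x -> 0 <= y -> 1 <= p ->
  x `^ p + y `^ p <= (x + y) `^ p.
Proof.
move=> x0 y0 p1; have p0 : 0 < p by rewrite (lt_le_trans ltr01).
rewrite -!(mulr_powRB1 _ p0) ?addr_ge0// mulrDl.
by apply: lerD; apply: ler_wpM2l => //; apply: ge0_ler_powR;
  rewrite ?subr_ge0 ?nnegrE ?addr_ge0 ?lerDl ?lerDr.
Qed.

(** * Variation along partitions *)

Section variation.
Context (R : realType) (T : Type) (delta : T -> T -> \bar R) (h : R -> T).
Local Open Scope ereal_scope.

(** The sum in [dist_variation] in recursive form, which needs no default for [nth] and splits along
    concatenation. *)
Fixpoint path_variation (s : R) (p : seq R) : \bar R :=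
  if p is t :: q then delta (h s) (h t) + path_variation t q else 0.

Lemma path_variationE z s p :
  \sum_(0 <= i < size p) delta (h (nth z (s :: p) i)) (h (nth z (s :: p) i.+1))
  = path_variation s p.
Proof.
elim: p s => [|t p IH] s; first by rewrite big_nil.
by rewrite big_nat_recl//= -IH.
Qed.

Lemma path_variation_cat s p q :
  path_variation s (p ++ q) = path_variation s p + path_variation (last s p) q.
Proof. by elim: p s => [|t p IH] s /=; rewrite ?add0e// IH addeA. Qed.

Lemma dist_variationE s t :
  dist_variation delta h s t
  = ereal_sup [set path_variation s p | p in itv_partition s t].
Proof.
by congr ereal_sup; apply: eq_imagel => p _; exact: path_variationE.
Qed.

Lemma le_dist_variation s t : (s < t)%R ->
  delta (h s) (h t) <= dist_variation delta h s t.
Proof.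
move=> st; rewrite dist_variationE; apply: ereal_sup_ubound.
by exists [:: t]; [exact: itv_partition1|rewrite /= adde0].
Qed.

(** Concatenating a partition of [[r, s]] with one of [[s, t]] gives a partition of [[r, t]]. *)
Lemma dist_variation_superadd r s t :
  dist_variation delta h r s < +oo -> dist_variation delta h s t < +oo ->
  dist_variation delta h r s + dist_variation delta h s t
  <= dist_variation delta h r t.
Proof.
rewrite !dist_variationE => rs st; apply: ge_adde_ereal_sup => //.
move=> _ _ [p rp <-] [q sq <-]; apply: ereal_sup_ubound.
exists (p ++ q); first exact: itv_partition_cat rp sq.
by rewrite path_variation_cat; case: rp => _ /eqP ->.
Qed.

(** By induction on the partition, superadditivity of [w] merges its cells one at a time. It serves
    with [w] the Hölder bound, and with [w] the Hausdorff variation to bound the variation of the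
    selection. *)
Lemma ge_dist_variation (w : R -> R -> \bar R) (a b s t : R) :
  (forall u v, (a <= u)%R -> (u < v)%R -> (v <= b)%R ->
     delta (h u) (h v) <= w u v) ->
  (forall u v z, (a <= u)%R -> (u < v)%R -> (v < z)%R -> (z <= b)%R ->
     w u v + w v z <= w u z) ->
  (a <= s)%R -> (s < t)%R -> (t <= b)%R -> dist_variation delta h s t <= w s t.
Proof.
move=> hw ww as_ st tb; rewrite dist_variationE.
apply: ge_ereal_sup => _ [p + <-].
elim: p => [|u p IH] in s as_ st *.
  by move=> /itv_partition_nil est; move: st; rewrite est ltxx.
case: p IH => [_|v p IH] [].
  by rewrite /= andbT adde0 => su /eqP ut; rewrite ut hw// -ut.
move=> /= /andP[su /andP[uv vp]] pt.
have utp : itv_partition u t (v :: p) by split => //=; rewrite uv.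
have ut : (u < t)%R.
  by rewrite (lt_le_trans uv)//; apply: itv_partition_le (itv_partition_cons utp).
apply: le_trans (ww _ _ _ as_ su ut tb).
apply: leeD; first by rewrite hw// (le_trans (ltW ut)).
by apply: IH => //; rewrite (le_trans as_)// ltW.
Qed.

End variation.

(** * Nearest points and the Hausdorff distance *)

Section hausdorff.
Context (R : realType) (X : metricType R).

Lemma mdist_continuous (x : X) : continuous (mdist x : X -> R).
Proof.
move=> y; apply/cvgrPdist_le => e e0.
near=> z.
have yz : mdist y z <= e.
  apply: ltW; near: z.
  by have := nbhsx_ballx y _ e0; rewrite ballEmdist.
rewrite ler_norml lerBlDr lerNl opprB lerBlDr; apply/andP; split.
  by rewrite (le_trans (metric_triangle _ y _))// addrC lerD2r.
by rewrite (le_trans (metric_triangle _ z _))// addrC lerD2r metric_sym.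
Unshelve. all: by end_near. Qed.

Lemma hausdorff_dist_sym (A B : set X) : hausdorff_dist A B = hausdorff_dist B A.
Proof.
rewrite /hausdorff_dist maxC; congr maxe; congr ereal_sup;
  apply: eq_imagel => x _; congr ereal_inf; apply: eq_imagel => y _;
  by rewrite /dist metric_sym.
Qed.

(** On the compact [B] the continuous function [mdist x] has a minimum, at most the infimum at [x],
    which is one of the terms of the first supremum. *)
Lemma hausdorff_dist_attained (A B : set X) (x : X) :
  nonempty_compacts B -> A x ->
  exists2 y, B y & (dist x y <= hausdorff_dist A B)%E.
Proof.
move=> [B0 cB] Ax.
have /(compact_EVT_min B0 cB)[y By ymin] : {within B, continuous (mdist x : X -> R)}.
  exact/continuous_subspaceT/mdist_continuous.
exists y; first exact: set_mem.
rewrite /hausdorff_dist le_max; apply/orP; left.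
apply: (@le_trans _ _ (ereal_inf [set dist x z | z in B])); last first.
  by apply: ereal_sup_ubound; exists x.
by apply: le_ereal_inf_tmp => _ [z Bz <-]; rewrite lee_fin ymin// inE.
Qed.

End hausdorff.

(** * Selections controlled by a superadditive weight *)

Section selection.
Context (R : realType) (X : metricType R).

(** Greedy choice along the chain: each point is chosen near the previous one, and superadditivity
    of [w] absorbs the triangle inequality. The relation is left abstract so that both directions of
    time are covered. *)
Lemma chain_selection (T : eqType) (r : rel T) (D : set T) (F : T -> set X)
    (w : T -> T -> R) :
  transitive r -> irreflexive r ->
  (forall s t, D s -> D t -> r s t -> forall y, F s y ->
     exists2 z, F t z & mdist y z <= w s t) ->
  (forall s t u, D s -> D t -> D u -> r s t -> r t u ->
     w s t + w t u <= w s u) ->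
  forall (p : seq T) t0 x0, path r t0 p -> {in t0 :: p, forall t, D t} ->
  F t0 x0 ->
  exists f : T -> X, [/\ f t0 = x0, {in t0 :: p, forall t, F t (f t)} &
    {in t0 :: p &, forall s t, r s t -> mdist (f s) (f t) <= w s t}].
Proof.
move=> rtr rirr step ww; elim=> [|t1 p IH] t0 x0.
  move=> _ _ Fx0; exists (fun=> x0); split => //.
    by move=> t; rewrite inE => /eqP ->.
  by move=> s t; rewrite !inE => /eqP -> /eqP ->; rewrite rirr.
move=> t0p Dp Fx0; have /= /andP[r01 t1p] := t0p.
have Dt0 : D t0 by apply: Dp; rewrite mem_head.
have Dt1p : {in t1 :: p, forall t, D t}.
  by move=> t tp; apply: Dp; rewrite inE tp orbT.
have Dt1 : D t1 by apply: Dt1p; rewrite mem_head.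
have [x1 Fx1 x01] := step _ _ Dt0 Dt1 r01 _ Fx0.
have [f [f1 fF fw]] := IH t1 x1 t1p Dt1p Fx1.
have r0 t : t \in t1 :: p -> r t0 t by apply/allP; exact: order_path_min t0p.
have ne0 t : t \in t1 :: p -> (t == t0) = false.
  by move=> /r0 r0t; apply/negbTE; apply: contraTneq r0t => ->; rewrite rirr.
exists (fun t => if t == t0 then x0 else f t); split; first by rewrite eqxx.
  move=> t; rewrite in_cons; case: eqVneq => [-> //|_ /=]; exact: fF.
move=> s t; rewrite !(in_cons t0).
case: (eqVneq s t0) => [->|st0] /= sp; case: (eqVneq t t0) => [->|tt0] /= tp rst.
- by rewrite rirr in rst.
(* From [t0] to a later [t] the estimate passes through [x1], the value at the next time [t1]. *)
- apply: (le_trans (metric_triangle _ x1 _)).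
  have [->|tt1] := eqVneq t t1; first by rewrite f1 mdistxx addr0.
  have r1t : r t1 t.
    move: tp; rewrite in_cons (negbTE tt1)/=; apply/allP.
    exact: order_path_min t1p.
  apply: le_trans (ww _ _ _ Dt0 Dt1 (Dt1p _ tp) r01 r1t).
  by rewrite lerD// -f1 fw// mem_head.
- by have := rtr _ _ _ rst (r0 _ sp); rewrite rirr.
- exact: fw.
Qed.

Context (d : Order.disp_t) (T : orderType d) (D : set T) (F : T -> set X)
  (w : T -> T -> R) (theta : T) (x : X).
Hypothesis F_compact : forall t, D t -> nonempty_compacts (F t).
Hypothesis stepr : forall s t, D s -> D t -> (s < t)%O -> forall y, F s y ->
  exists2 z, F t z & mdist y z <= w s t.
Hypothesis stepl : forall s t, D s -> D t -> (s < t)%O -> forall z, F t z ->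
  exists2 y, F s y & mdist y z <= w s t.
Hypothesis w_superadd : forall s t u, D s -> D t -> D u -> (s < t)%O ->
  (t < u)%O -> w s t + w t u <= w s u.
Hypothesis Dtheta : D theta.
Hypothesis Fx : F theta x.

(** Two chains leave [theta], one upwards and one downwards; both start at [x], so they can be glued
    there. *)
Lemma finite_selection (S : seq T) : {in S, forall t, D t} ->
  exists f : T -> X, [/\ f theta = x, {in S, forall t, F t (f t)} &
    {in S &, forall s t, (s < t)%O -> mdist (f s) (f t) <= w s t}].
Proof.
move=> DS.
pose pr := sort <=%O (undup [seq t <- S | (theta < t)%O]).
(* Going left from theta is going right in the dual order. *)
pose pl : seq T := @sort T^d <=%O (@undup T^d [seq t <- S | (t < theta)%O]).
have prE t : (t \in pr) = (theta < t)%O && (t \in S).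
  by rewrite mem_sort mem_undup mem_filter.
have plE t : (t \in pl) = (t < theta)%O && (t \in S).
  by rewrite mem_sort mem_undup mem_filter.
have ppr : path <%O theta pr.
  rewrite (path_sortedE lt_trans) sort_lt_sorted undup_uniq andbT.
  by apply/allP => t; rewrite prE => /andP[].
have ppl : @path T^d <%O theta pl.
  rewrite (path_sortedE lt_trans) sort_lt_sorted undup_uniq andbT.
  by apply/allP => t; rewrite plE => /andP[].
have Dpr : {in theta :: pr, forall t, D t}.
  by move=> t; rewrite in_cons prE => /predU1P[->//|/andP[_ /DS]].
have Dpl : {in theta :: pl, forall t, D t}.
  by move=> t; rewrite in_cons plE => /predU1P[->//|/andP[_ /DS]].
have [f [f0 fF fw]] := @chain_selection _ <%O D F w lt_trans ltxx
  stepr w_superadd _ _ _ ppr Dpr Fx.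
have [||f' [f'0 f'F f'w]] := @chain_selection T^d <%O D F (fun s t => w t s) lt_trans ltxx
  _ _ _ _ _ ppl Dpl Fx.
- move=> s t Ds Dt ts y Fy; have [z Fz zy] := stepl _ _ Dt Ds ts _ Fy.
  by exists z; rewrite // metric_sym.
- by move=> s t u Ds Dt Du ts ut; rewrite addrC; exact: w_superadd.
have Spr t : t \in S -> (theta <= t)%O -> t \in theta :: pr.
  by rewrite in_cons prE le_eqVlt eq_sym => -> /orP[->//|->]; rewrite orbT.
have Spl t : t \in S -> (t <= theta)%O -> t \in theta :: pl.
  by rewrite in_cons plE le_eqVlt => -> /orP[->//|->]; rewrite orbT.
exists (fun t => if (theta <= t)%O then f t else f' t); split.
- by rewrite lexx.
- move=> t tS; case: leP => [tt|/ltW tt]; [apply/fF/Spr|apply/f'F/Spl] => //.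
move=> s t sS tS st.
case: (leP theta s) => hs; case: (leP theta t) => ht.
- by rewrite fw// Spr.
- by have := lt_trans ht (le_lt_trans hs st); rewrite ltxx.
(* Here [theta] separates [s] from [t]: the estimate goes through [x], with superadditivity at
   [theta]. *)
- have ws : mdist (f' s) x <= w s theta.
    rewrite metric_sym -f'0; apply: f'w => //; first exact: mem_head.
    by apply: Spl => //; exact: ltW.
  move: ht; rewrite le_eqVlt => /predU1P[<-|ht]; first by rewrite f0.
  apply: (le_trans (metric_triangle _ x _)).
  apply: le_trans (w_superadd _ _ _ (DS _ sS) Dtheta (DS _ tS) hs ht).
  rewrite lerD// -f0; apply: fw => //; first exact: mem_head.
  by apply: Spr => //; exact: ltW.
- by rewrite metric_sym; apply: f'w => //; apply: Spl => //; exact: ltW.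
Qed.

Lemma superadditive_selection : exists f : T -> X,
  [/\ forall t, D t -> F t (f t), f theta = x &
    forall s t, D s -> D t -> (s < t)%O -> mdist (f s) (f t) <= w s t].
Proof.
(* Taking A theta = {x} forces every selection of A through x; the junk value
   {x} outside D keeps the factors compact. *)
pose A t := if `[< D t >] && (t != theta) then F t else [set x].
have A_compact t : compact (A t).
  rewrite /A; case: ifP => [/andP[/asboolP/F_compact[]]//|_].
  exact: compact_set1.
have AF t y : D t -> A t y -> F t y.
  move=> Dt; rewrite /A asboolT//=; case: eqVneq => //= -> -> //.
(* Membership in [A] is imposed at all times, the metric bound only between times of the finite list
   [S]. *)
pose B (S : seq T) := [set f : forall t : T, X | (forall t, A t (f t)) /\
  {in S &, forall s t, D s -> D t -> (s < t)%O -> mdist (f s) (f t) <= w s t}].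
have B0 S : B S !=set0.
  (* Adding [theta] forces the value [x] there; the times outside [D] are dropped because finite
     selections need [D]. *)
  pose S' := theta :: [seq t <- S | `[< D t >]].
  have DS' : {in S', forall t, D t}.
    move=> t; rewrite in_cons mem_filter => /predU1P[->//|/andP[]].
    by move=> /asboolP.
  have [f [f0 fF fw]] := finite_selection S' DS'.
  have A0 t : exists y, A t y.
    rewrite /A; case: ifP => [/andP[/asboolP/F_compact[]]//|_]; by exists x.
  have [h hA] := choice A0.
  exists (fun t => if t \in S' then f t else h t); split => [t|s t sS tS Ds Dt st].
    case: ifP => [tS'|_]; last exact: hA.
    rewrite /A asboolT/=; last exact: DS'.
    by case: eqVneq => [->|_] /=; [rewrite f0|exact: fF].
  have inS' u : u \in S -> D u -> u \in S'.
    by move=> uS Du; rewrite in_cons mem_filter asboolT// uS orbT.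
  by rewrite !inS'//; apply: fw => //; exact: inS'.
(* The sets [B S] form a filter base: [B (S1 ++ S2)] lies in both [B S1] and [B S2]. *)
have PF : ProperFilter (filter_from setT B).
  apply: filter_from_proper => [|S _]; last exact: B0.
  apply: filter_from_filter => [|S1 S2 _ _]; first by exists [::].
  exists (S1 ++ S2) => // f [fA fw]; split; split => // s t sS tS;
    by apply: fw; rewrite mem_cat ?sS ?tS ?orbT.
have [|f [fA fB]] := @tychonoff T (fun=> X) A A_compact _ PF.
  by exists [::] => // f [].
exists f; split => [t Dt||s t Ds Dt st].
- exact/AF/fA.
- by have := fA theta; rewrite /A eqxx andbF.
(* Some [h] in [B [:: s; t]] is within [e / 2] of the cluster point [f] at both [s] and [t], so the
   bound for [h] passes to [f] up to [e]. *)
apply/ler_addgt0Pr => e e0.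
(* The type ascription selects the product topology, where evaluation at [u] is continuous. *)
have nbh (u : T) : nbhs (f : ArrowAsProduct.prod__canonical__topology_structure_Topological (fun _ : T => X))
    [set h | ball (f u) (e / 2) (h u)].
  apply: (@proj_continuous T (fun=> X) u f); apply: nbhsx_ballx.
  by rewrite divr_gt0.
have FB : filter_from setT B (B [:: s; t]) by exists [:: s; t].
have [h [[_ hw] []]] := fB _ _ FB (filterI (nbh s) (nbh t)).
rewrite /= !ballEmdist /= => hs ht.
apply: (le_trans (metric_triangle _ (h s) _)).
rewrite [e]splitr addrCA; apply: lerD; first exact: ltW.
apply: (le_trans (metric_triangle _ (h t) _)); apply: lerD.
  by apply: hw; rewrite ?inE ?eqxx ?orbT.
by rewrite metric_sym; exact: ltW.
Qed.

End selection.

(** * The Hölder bound on the Hausdorff variation *)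

Section hausdorff_holder.
Context (R : realType) (X : metricType R) (a b : R) (g : R -> R) (F : R -> set X)
  (alpha L : R).
Hypothesis g_ndecr : {in `[a, b] &, {homo g : s t / s <= t}}.
Hypothesis alpha_ge1 : 1 <= alpha.
Hypothesis F_holder : is_holder (@hausdorff_dist R X) a b g alpha F L.

(** As [g] is monotone, its increments are nonnegative and add up; as [alpha >= 1], their powers are
    superadditive, so the Hölder bound is a superadditive weight. *)
Lemma dist_variation_holder s t : a <= s -> s < t -> t <= b ->
  (dist_variation (@hausdorff_dist R X) F s t
   <= (L * `|g t - g s| `^ alpha)%:E)%E.
Proof.
have [L0 hL] := F_holder.
apply: (ge_dist_variation _ _ _ _ (fun u v => (L * `|g v - g u| `^ alpha)%:E)).
  move=> u v au uv vb; apply: hL; rewrite in_itv/=.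
    by rewrite au (le_trans (ltW uv)).
  by rewrite vb (le_trans au)// ltW.
move=> u v z au uv vz zb.
have av := le_trans au (ltW uv); have vb := le_trans (ltW vz) zb.
have uab : u \in `[a, b] by rewrite in_itv/= au (le_trans (ltW uv)).
have vab : v \in `[a, b] by rewrite in_itv/= av vb.
have zab : z \in `[a, b] by rewrite in_itv/= zb (le_trans av)// ltW.
have guv : 0 <= g v - g u by rewrite subr_ge0 g_ndecr// ltW.
have gvz : 0 <= g z - g v by rewrite subr_ge0 g_ndecr// ltW.
have -> : g z - g u = (g v - g u) + (g z - g v) by rewrite [RHS]addrC subrKA.
rewrite -EFinD lee_fin -mulrDr ler_wpM2l//.
by rewrite (ger0_norm (addr_ge0 guv gvz)) !ger0_norm// powR_superadd.
Qed.

End hausdorff_holder.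

(** * The Lipschitz selection for the Hausdorff variation *)

Theorem theorem5p3 (R : realType) (X : metricType R) (a b : R) (hab : a <= b)
    (g : R -> R) (hg : {in `[a, b] &, {homo g : s t / s <= t}})
    (F : R -> set X) (hF : forall t, t \in `[a, b] -> nonempty_compacts (F t))
    (alpha : R) (halpha : 1 <= alpha)
    (hFholder :
      (holder_const (@hausdorff_dist R X) a b g alpha F < +oo)%E)
    (theta : R) (htheta : theta \in `[a, b]) (x : X) (hx : F theta x) :
  exists f : R -> X,
    [/\ forall t, t \in `[a, b] -> F t (f t),
        f theta = x,
        forall s t, s \in `[a, b] -> t \in `[a, b] -> s < t ->
          [/\ (dist (f s) (f t)
                 <= dist_variation (@hausdorff_dist R X) F s t)%E,
              (dist_variation (@hausdorff_dist R X) F s t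
                 <= holder_const (@hausdorff_dist R X) a b g alpha F
                    * (`|g t - g s| `^ alpha)%:E)%E &
              (dist_variation (@dist R X) f s t
                 <= dist_variation (@hausdorff_dist R X) F s t)%E] &
        (holder_const (@dist R X) a b g alpha f
           <= holder_const (@hausdorff_dist R X) a b g alpha F)%E].
Proof.
(* The best constant is attained, so it may be replaced by a real Hölder constant [L]. *)
have [L [EL holdL _]] := holder_const_min hFholder.
rewrite EL.
pose V s t := dist_variation (@hausdorff_dist R X) F s t.
have inab s t u : s \in `[a, b] -> t \in `[a, b] -> s <= u -> u <= t ->
    u \in `[a, b].
  rewrite !in_itv/= => /andP[as_ _] /andP[_ tb] su ut.
  by rewrite (le_trans as_)// (le_trans ut).
have VL s t : s \in `[a, b] -> t \in `[a, b] -> s < t ->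
    (V s t <= (L * `|g t - g s| `^ alpha)%:E)%E.
  rewrite !in_itv/= => /andP[as_ _] /andP[_ tb] st.
  exact: (dist_variation_holder _ _ a b).
have Voo s t : s \in `[a, b] -> t \in `[a, b] -> s < t -> (V s t < +oo)%E.
  by move=> sab tab st; rewrite (le_lt_trans (VL _ _ sab tab st))// ltry.
have dV s t y : s \in `[a, b] -> t \in `[a, b] -> s < t -> F s y ->
    exists2 z, F t z & (dist y z <= V s t)%E.
  move=> sab tab st Fy.
  have [z Fz yz] := hausdorff_dist_attained _ _ _ _ _ (hF _ tab) Fy.
  by exists z => //; rewrite (le_trans yz)//; exact: le_dist_variation.
(* Nonnegativity comes from a point of the nonempty [F s]: [V s t] bounds a distance from it.
   Finiteness makes [fine (V s t)] a faithful real weight. *)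
have Vfin s t : s \in `[a, b] -> t \in `[a, b] -> s < t -> V s t \is a fin_num.
  move=> sab tab st; rewrite ge0_fin_numE; first exact: Voo.
  have [y Fy] := (hF _ sab).1; have [z _] := dV _ _ _ sab tab st Fy.
  by apply: le_trans; rewrite lee_fin mdist_ge0.
have Vsuper r s t : r \in `[a, b] -> s \in `[a, b] -> t \in `[a, b] ->
    r < s -> s < t -> (V r s + V s t <= V r t)%E.
  by move=> rab sab tab rs st; apply: dist_variation_superadd; apply: Voo.
have [|||f [fF f0 fw]] := @superadditive_selection R X _ R
    [set t | t \in `[a, b]] F (fun s t => fine (V s t)) theta x hF _ _ _ htheta hx.
- move=> s t sab tab st y Fy; have [z Fz yz] := dV _ _ _ sab tab st Fy.
  by exists z => //; rewrite -lee_fin fineK// Vfin.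
(* The step to the left uses the symmetry of the Hausdorff distance. *)
- move=> s t sab tab st z Fz.
  have [y Fy yz] := hausdorff_dist_attained _ _ _ _ _ (hF _ sab) Fz.
  exists y => //; rewrite metric_sym -lee_fin fineK ?Vfin//.
  by apply: le_trans yz _; rewrite hausdorff_dist_sym; exact: le_dist_variation.
- move=> r s t rab sab tab rs st.
  by rewrite -lee_fin EFinD !fineK ?Vfin ?Vsuper// (lt_trans rs).
have fV s t : s \in `[a, b] -> t \in `[a, b] -> s < t ->
    (dist (f s) (f t) <= V s t)%E.
  by move=> sab tab st; rewrite -(fineK (Vfin _ _ sab tab st)) lee_fin fw.
exists f; split=> //.
- move=> s t sab tab st; split; [exact: fV|exact: VL|].
  (* [V] is superadditive and dominates the increments of [f], hence also its variation. *)
  apply: (ge_dist_variation _ _ _ _ V s t) => // [u v su uv vt|u v z su uv vz zt].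
    by apply: fV => //; apply: (inab s t) => //;
      rewrite ?(le_trans (ltW uv))// (le_trans su)// ltW.
  have sv := le_trans su (ltW uv); have vt := le_trans (ltW vz) zt.
  by apply: Vsuper => //; apply: (inab s t) => //;
    rewrite ?(le_trans (ltW uv))// (le_trans sv)// ltW.
(* It suffices that [L] is a Hölder constant of [f]: the case [s < t] is known, [t < s] follows by
   symmetry, and for [s = t] the distance is zero. *)
- apply: ereal_inf_lbound; exists L => //; split; first by case: holdL.
  have fL s t : s \in `[a, b] -> t \in `[a, b] -> s < t ->
      (dist (f s) (f t) <= (L * `|g t - g s| `^ alpha)%:E)%E.
    by move=> sab tab st; rewrite (le_trans (fV _ _ sab tab st))// VL.
  move=> s t sab tab; case: (ltgtP s t) => [st|ts|->]; first exact: fL.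
    by rewrite /dist metric_sym distrC; exact: fL.
  rewrite /dist mdistxx lee_fin mulr_ge0 ?powR_ge0//; by case: holdL.
Qed.
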